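(* Let $1\le L\le N$ be integers and let $\mathbf{w}\in\{0,1\}^N$ be a binary pilot mask with exactly $L$ entries equal to $1$. Let $h(q)=\sum_{n=0}^{N-1}w_nw_{\langle n-q\rangle_N}$ and $\mathcal{D}_h=\{q\in\mathbb{Z}_N:\ q\neq 0,\ h(q)=L\}$. The set $\mathcal{D}_h\neq\varnothing$ if and only if $\gcd(N,L)>1$ and $\mathbf{w}$ has period $T_{\mathbf{w}}=N/\lambda_{N,L}$, i.e. $w_n=w_{\langle n-T_{\mathbf{w}}\rangle_N}$ for all $n\in\mathbb{Z}_N$, where $\lambda_{N,L}>1$ is a common divisor of $N$ and $L$. In this case, $\mathcal{D}_h$ takes the following form: $$\mathcal{D}_h=\{iT_{\mathbf{w}}:\ i=1,\dots,\lambda_{N,L}-1\}.$$ It follows that $\mathrm{Card}(\mathcal{D}_h)\leq L-1$; the equality is satisfied only when $L\mid N$ and the pilot pattern $\{n:w_n=1\}$ is equally spaced with a period of $N/L$.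
   Context: $\mathbb{Z}_N=\{0,1,\dots,N-1\}$; $\langle\cdot\rangle_N$ denotes reduction modulo $N$; vectors are indexed from $0$; $\mathrm{Card}$ denotes the number of elements; $a\mid b$ means that $b$ is a multiple of $a$. A pattern with $L$ ones is equally spaced with period $N/L$ if $\{n:w_n=1\}=\{i_0+lN/L:\ l=0,\dots,L-1\}$ for some $i_0\in\{0,\dots,N/L-1\}$.
   Formalization: In the formula for D_h, T_w is taken to be the least positive period of w, with λ = N/T_w (shown to exist); for another period N/λ the formula fails, e.g. w all ones, N = L = 4, λ = 2 gives D_h = {1,2,3}, not {2}. *)

(* Defs.v *)
From mathcomp Require Import all_boot all_order all_algebra.

Set Implicit Arguments.
Unset Strict Implicit.
Unset Printing Implicit Defensive.

(* The residue of [n - q] modulo [N], computed in [nat] without truncation;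
   [N] is positive because ['I_N] contains [n]. *)
Definition cyc_sub (N : nat) (n : 'I_N) (q : nat) : 'I_N :=
  Ordinal (ltn_pmod (n + (N - q %% N)) (leq_ltn_trans (leq0n n) (ltn_ord n))).

Lemma cyc_subE (N : nat) (n : 'I_N) (q : nat) :
  (cyc_sub n q : int) = ((n%:Z - q%:Z) %% N)%Z.
Proof.
have N_gt0 : 0 < N by exact: leq_ltn_trans (leq0n n) (ltn_ord n).
rewrite /= -modz_nat PoszD -subzn; last exact/ltnW/ltn_pmod.
rewrite GRing.addrCA modzDl -modz_nat.
by rewrite -[LHS]modzDmr modzNm modzDmr.
Qed.

Section Mask.
Variables (N : nat) (w : {ffun 'I_N -> bool}).

Definition pilots : {set 'I_N} := [set n | w n].

Definition h (q : nat) : nat := \sum_(n < N) w n * w (cyc_sub n q).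

Definition Dh (L : nat) : {set 'I_N} :=
  [set q : 'I_N | (q != 0 :> nat) && (h q == L)].

Definition has_period (T : nat) : Prop := forall n, w n = w (cyc_sub n T).

(* A mask has many periods in the sense above, and only its least one generates
   [Dh]: the all-one mask of length 4 has period 2, but its [Dh] is
   [{1, 2, 3}]. *)
Definition least_period (T : nat) : Prop :=
  [/\ 0 < T, has_period T & forall T', 0 < T' -> has_period T' -> T <= T'].

(* Meaningful only when [L] divides [N]. *)
Definition equally_spaced (L : nat) : Prop :=
  exists2 i0 : nat, i0 < N %/ L
  & pilots = [set n : 'I_N | val n \in [seq i0 + l * (N %/ L) | l <- iota 0 L]].

End Mask.

(* Main.v *)
(* [h q = L] says that the shift by [q] maps the pilots into the pilots, hence,
   by cardinality, that [q] is a period of the mask. The periods are exactly the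
   multiples of the least one, [T]. As [N] is a period, [T] divides [N], and a
   count over the [N %/ T] blocks of length [T] shows that [lam = N %/ T] divides
   [L]. If [lam = L] then each block contains exactly one pilot. *)
Require Import Defs.
From mathcomp Require Import all_boot all_order all_algebra.

Set Implicit Arguments.
Unset Strict Implicit.
Unset Printing Implicit Defensive.

Definition periodic (A : Type) (f : nat -> A) (T : nat) : Prop :=
  forall m, f (m + T) = f m.

Section Periodic.
Variables (A : Type) (f : nat -> A).

Lemma periodic_mull (T k m : nat) : periodic f T -> f (m + k * T) = f m.
Proof.
move=> fT; elim: k => [|k IHk]; first by rewrite mul0n addn0.
by rewrite mulSnr addnA fT.
Qed.

Lemma periodic_modn (T m : nat) : periodic f T -> f (m %% T) = f m.
Proof. by move=> fT; rewrite [in RHS](divn_eq m T) addnC periodic_mull. Qed.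

(** The remainder [T' %% T] is again a period and is smaller than [T], so minimality forces it to be
    0. *)
Lemma least_periodic_dvdn (T T' : nat) :
    0 < T -> periodic f T ->
    (forall T'', 0 < T'' -> periodic f T'' -> T <= T'') ->
  periodic f T' -> T %| T'.
Proof.
move=> T_gt0 fT minT fT'; rewrite /dvdn -leqn0 leqNgt; apply/negP => r_gt0.
have: T <= T' %% T.
  apply: minT => // m; rewrite -(periodic_mull (T' %/ T) _ fT) -addnA.
  by rewrite (addnC (T' %% T)) -divn_eq fT'.
by rewrite leqNgt ltn_mod T_gt0.
Qed.

End Periodic.

Lemma count_periodic (f : pred nat) (T k : nat) :
  periodic f T -> count f (iota 0 (k * T)) = k * count f (iota 0 T).
Proof.
move=> fT; elim: k => // k IHk.
(* Writing the start of the last block as [k * T + 0] exhibits that block as a translate of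
   [iota 0 T]. *)
rewrite mulSnr iotaD count_cat IHk add0n mulSnr -[in iota (k * T)](addn0 (k * T)) iotaDl.
rewrite count_map; congr (_ + _); apply: eq_count => m /=.
by rewrite addnC periodic_mull.
Qed.

Lemma count_eq1_iota (f : pred nat) (n : nat) :
    count f (iota 0 n) = 1 ->
  exists2 i, i < n & forall m, m < n -> f m = (m == i).
Proof.
rewrite -size_filter => sz1.
have mem_f m : m < n -> f m = (m \in filter f (iota 0 n)).
  by move=> lt_mn; rewrite mem_filter mem_iota /= add0n lt_mn andbT.
have [i def_s] : exists i, filter f (iota 0 n) = [:: i].
  by case: (filter f _) sz1 => [|i []] // _; exists i.
exists i.
  have: i \in filter f (iota 0 n) by rewrite def_s mem_head.
  by rewrite mem_filter mem_iota => /andP[].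
by move=> m /mem_f ->; rewrite def_s mem_seq1.
Qed.

Lemma card_ord_seq_le (N : nat) (s : seq nat) :
  #|[set q : 'I_N | val q \in s]| <= size s.
Proof.
rewrite cardE -(size_map val); apply: uniq_leq_size.
  by rewrite map_inj_uniq ?enum_uniq //; apply: val_inj.
by move=> x /mapP[q]; rewrite mem_enum inE => ? ->.
Qed.

Section CyclicMask.
Variables (N : nat) (w : {ffun 'I_N -> bool}).
Hypothesis N_gt0 : 0 < N.

(** The [N]-periodic extension of the mask to all of [nat], on which cyclic periods become ordinary
    ones. *)
Definition unroll (m : nat) : bool := w (Ordinal (ltn_pmod m N_gt0)).

Lemma unroll_ord (n : 'I_N) : unroll n = w n.
Proof. by congr (w _); apply: val_inj; rewrite /= modn_small. Qed.

Lemma periodic_unroll_length : periodic unroll N.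
Proof. by move=> m; congr (w _); apply: val_inj; rewrite /= modnDr. Qed.

Lemma modn_subnK (n q : nat) : (n + (N - q %% N)) %% N + q = n %[mod N].
Proof.
rewrite modnDml -modnDmr -addnA subnK ?modnDr //.
exact/ltnW/ltn_pmod.
Qed.

Lemma cyc_sub_inj (q : nat) : injective (fun n : 'I_N => cyc_sub n q).
Proof.
move=> n n' /(congr1 val) /= eq_nn'; apply: val_inj => /=.
rewrite -(modn_small (ltn_ord n)) -(modn_small (ltn_ord n')).
by rewrite -(modn_subnK n q) -(modn_subnK n' q) eq_nn'.
Qed.

Lemma has_periodP (T : nat) : has_period w T <-> periodic unroll T.
Proof.
split=> wT m.
  rewrite /unroll wT; congr (w _); apply: val_inj => /=.
  (* Adding [T] to both sides modulo [N] undoes the backward shift of [cyc_sub]. *)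
  apply/eqP; rewrite -(eqn_modDr T) -modnDml.
  by rewrite modn_subnK modn_mod.
rewrite -!unroll_ord -[RHS]wT; congr (w _); apply: val_inj => /=.
by rewrite modn_subnK.
Qed.

Lemma card_pilots_count : #|pilots w| = count unroll (iota 0 N).
Proof.
rewrite -sum1_card -sum1_count -[N in iota 0 N]subn0 big_mkord.
by apply: eq_bigl => n; rewrite inE unroll_ord.
Qed.

(** [h w q] is the size of the intersection of the pilot set with a translate of it. Both have the
    same cardinality because the shift is injective, so a full intersection makes them equal. *)
Lemma h_eq_cardP (q : nat) : h w q = #|pilots w| <-> has_period w q.
Proof.
have hE : h w q = #|pilots w :&: [set n | w (cyc_sub n q)]|.
  rewrite /h -sum1_card [RHS]big_mkcond /=; apply: eq_bigr => n _.
  by rewrite !inE mulnb; case: (_ && _).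
have cardS : #|[set n | w (cyc_sub n q)]| = #|pilots w|.
  rewrite -(card_preimset (pilots w) (@cyc_sub_inj q)).
  by apply: eq_card => n; rewrite !inE.
rewrite hE; split=> [cardI n | wq].
  have /eqP eqI : pilots w :&: [set n | w (cyc_sub n q)] == pilots w.
    by rewrite eqEcard subsetIl cardI leqnn.
  have sub : pilots w \subset [set n | w (cyc_sub n q)].
    by apply/setIidPl.
  have /eqP/setP/(_ n) : pilots w == [set n | w (cyc_sub n q)].
    by rewrite eqEcard sub cardS leqnn.
  by rewrite !inE.
by apply: eq_card => n; rewrite !inE -wq andbb.
Qed.

Lemma mem_Dh (q : 'I_N) :
  reflect (0 < q /\ has_period w q) (q \in Dh w #|pilots w|).
Proof.
rewrite inE -lt0n; apply: (iffP andP) => -[q_gt0].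
  by move/eqP/h_eq_cardP.
by move/h_eq_cardP/eqP.
Qed.

Lemma least_period_exists : exists T, least_period w T.
Proof.
(* Being a period is a [Prop]; its characterization through [h] is decidable, which allows taking a
   minimum. *)
pose P T := (0 < T) && (h w T == #|pilots w|).
have exP : exists T, P T.
  exists N; rewrite /P N_gt0; apply/eqP/h_eq_cardP/has_periodP.
  exact: periodic_unroll_length.
case: (ex_minnP exP) => T /andP[T_gt0 /eqP/h_eq_cardP wT] minT.
exists T; split=> // T' T'_gt0 /h_eq_cardP/eqP hT'.
by apply: minT; rewrite /P T'_gt0.
Qed.

Section LeastPeriod.
Variable T : nat.
Hypothesis T_least : least_period w T.

Lemma least_period_dvdn (T' : nat) : has_period w T' <-> T %| T'.
Proof.
have [T_gt0 /has_periodP fT minT] := T_least.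
split=> [/has_periodP fT' | /dvdnP[k ->]].
  apply: (least_periodic_dvdn T_gt0 fT _ fT') => T'' T''_gt0 /has_periodP.
  exact: minT.
by apply/has_periodP => m; apply: periodic_mull.
Qed.

Lemma least_period_dvd_length : T %| N.
Proof. exact/least_period_dvdn/has_periodP/periodic_unroll_length. Qed.

Lemma card_pilots_blocks :
  #|pilots w| = N %/ T * count unroll (iota 0 T).
Proof.
have [_ /has_periodP fT _] := T_least.
by rewrite card_pilots_count -(count_periodic _ fT) divnK ?least_period_dvd_length.
Qed.

Lemma Dh_multiples :
  Dh w #|pilots w| =
    [set q : 'I_N | val q \in [seq i * T | i <- iota 1 (N %/ T - 1)]].
Proof.
have [T_gt0 _ _] := T_least.
apply/setP => q; rewrite [RHS]inE.
apply/mem_Dh/mapP => [[q_gt0 /least_period_dvdn Tq] | [i]].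
  exists (q %/ T); last by rewrite divnK.
  (* The upper end [1 + (N %/ T - 1)] of the range is [N %/ T] because [N %/ T] is positive; the
     bound on the quotient then comes from [q < N]. *)
  rewrite mem_iota divn_gt0 // dvdn_leq //= subnKC.
    by rewrite ltn_divRL ?least_period_dvd_length // divnK.
  by rewrite divn_gt0 // dvdn_leq // least_period_dvd_length.
rewrite mem_iota => /andP[i_gt0 _] ->; split; first by rewrite muln_gt0 i_gt0.
exact/least_period_dvdn/dvdn_mull.
Qed.

Lemma card_Dh_le : #|Dh w #|pilots w| | <= N %/ T - 1.
Proof.
rewrite Dh_multiples (leq_trans (card_ord_seq_le _ _)) //.
by rewrite size_map size_iota.
Qed.

(** The offset is the position of the only pilot in the first block, and the index [l] of a pilot
    [n] is its block number [n %/ T]. *)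
Lemma equally_spaced_least (L : nat) :
  0 < L -> #|pilots w| = L -> N %/ T = L -> equally_spaced w L.
Proof.
move=> L_gt0 cardL NT.
have [T_gt0 /has_periodP fT _] := T_least.
have def_T : N %/ L = T by rewrite -NT divnA ?least_period_dvd_length ?mulKn.
have /count_eq1_iota[i lt_iT fi] : count unroll (iota 0 T) = 1.
  apply/eqP; rewrite -(eqn_pmul2l L_gt0) muln1 -{1}NT -card_pilots_blocks.
  exact/eqP.
exists i; rewrite def_T //; apply/setP => n; rewrite !inE.
rewrite -unroll_ord -(periodic_modn _ fT) fi ?ltn_pmod //.
apply/eqP/mapP => [modnT | [l _ ->]].
  exists (n %/ T); last by rewrite -modnT addnC -divn_eq.
  by rewrite mem_iota add0n -NT ltn_divRL ?least_period_dvd_length //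
             (leq_ltn_trans (leq_divM n T)).
by rewrite addnC modnMDl modn_small.
Qed.

End LeastPeriod.
End CyclicMask.

Theorem proposition2 (N L : nat) (hL1 : 1 <= L) (hLN : L <= N)
    (w : {ffun 'I_N -> bool}) (hw : #|pilots w| = L) :
  (Dh w L <> set0 <->
     1 < gcdn N L /\
     exists lam : nat,
       [/\ 1 < lam, lam %| N, lam %| L & has_period w (N %/ lam)])
  /\ (Dh w L <> set0 ->
     exists lam : nat,
       [/\ 1 < lam, lam %| N, lam %| L, least_period w (N %/ lam)
         & Dh w L = [set q : 'I_N |
             val q \in [seq i * (N %/ lam) | i <- iota 1 (lam - 1)]]])
  /\ #|Dh w L| <= L - 1
  /\ (#|Dh w L| = L - 1 -> L %| N /\ equally_spaced w L).
Proof.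
have N_gt0 : 0 < N by apply: leq_trans hLN.
have [T T_least] := least_period_exists w N_gt0.
have [T_gt0 wT _] := T_least.
have TN := least_period_dvd_length N_gt0 T_least.
have lamN : N %/ T %| N by rewrite -{2}(divnK TN) dvdn_mulr.
have lamL : N %/ T %| L.
  by rewrite -hw (card_pilots_blocks N_gt0 T_least) dvdn_mulr.
(* With [lam = N %/ T] as witness, the period [N %/ lam] is [T] itself. *)
have lamT : N %/ (N %/ T) = T by rewrite divnA // mulKn.
have DhE := Dh_multiples N_gt0 T_least; rewrite hw in DhE.
have cardD := card_Dh_le N_gt0 T_least; rewrite hw in cardD.
have lam_le : N %/ T <= L by apply: dvdn_leq.
have lam_gt1 : Dh w L <> set0 -> 1 < N %/ T.
  (* A nonempty [Dh] has positive cardinality, which is at most [N %/ T - 1]. *)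
  move/eqP; rewrite -card_gt0 => D_gt0.
  by rewrite -subn_gt0; apply: leq_trans cardD.
split; [split | split; [|split]].
- move/lam_gt1 => lt1; split; last by exists (N %/ T); rewrite lamT.
  by apply: (leq_trans lt1); rewrite dvdn_leq ?gcdn_gt0 ?N_gt0 // dvdn_gcd lamN.
- case=> _ [lam [lam1 lam_N _ wlam]] D0.
  (* Here [N %/ lam] may be any period, not only the least one; lying strictly between 0 and [N], it
     is itself an element of [Dh]. *)
  have lam_gt0 : 0 < lam by apply: ltnW.
  have lt_N : N %/ lam < N by apply: ltn_Pdiv.
  have : Ordinal lt_N \in Dh w L.
    rewrite -hw; apply/(mem_Dh w N_gt0); split; last exact: wlam.
    by rewrite /= divn_gt0 // dvdn_leq.
  by rewrite D0 inE.
- by move/lam_gt1 => lt1; exists (N %/ T); rewrite lamT.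
- by apply: leq_trans cardD _; apply: leq_sub2r.
move=> cardDL.
have lamE : N %/ T = L.
  (* The bound [L - 1 <= N %/ T - 1] yields [L <= N %/ T] despite truncated subtraction, since
     [N %/ T] is at least 1. *)
  apply/eqP; rewrite eqn_leq lam_le /= -(leq_sub2rE (p := 1)) -?cardDL //.
  by rewrite divn_gt0 // dvdn_leq.
split; first by rewrite -lamE.
exact: (equally_spaced_least N_gt0 T_least).
Qed.
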